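(* Suppose that: (A) each $f_i$ and each $h_i$ is proper, closed and convex, each $f_i$ is $L_i$-smooth for some $L_i>0$, each $f_i+h_i$ is bounded from below, and the problem $\min_{x\in\mathbb{R}^d}\sum_{i\in\mathcal V}(f_i(x)+h_i(x))$ has a non-empty optimal solution set; (B) each $f_i$ is $\mu_i$-strongly convex for some $\mu_i>0$; (C) (total asynchrony) $\mathcal K_i$ is an infinite subset of $\mathbb{N}_0$ for each $i\in\mathcal V$, and $\lim_{k\to+\infty}s_{ij}^k=+\infty$ for all $i\in\mathcal V$ and $j\in\mathcal N_i$; (D) $\displaystyle \alpha\in\Bigl(0,\,2\min_{i\in\mathcal V}\frac{w_{ii}}{L_i}\Bigr)$. Then, for any initial point $\mathbf{x}^0\in\mathbb{R}^{nd}$, the sequence $\{\mathbf{x}^k\}$ generated by the asynchronous Prox-DGD converges to a fixed point of the synchronous Prox-DGD.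
   Context: $\mathcal G=(\mathcal V,\mathcal E)$ is an undirected connected graph with vertex set $\mathcal V=\{1,\dots,n\}$; $\mathcal E$ contains no self-loops; $\mathcal N_i=\{j:\{i,j\}\in\mathcal E\}$ and $\bar{\mathcal N}_i=\mathcal N_i\cup\{i\}$. For each $i\in\mathcal V$, $f_i:\mathbb{R}^d\to\mathbb{R}$ and $h_i:\mathbb{R}^d\to\mathbb{R}\cup\{+\infty\}$. A differentiable function $f$ is $L$-smooth if $\|\nabla f(y)-\nabla f(x)\|\le L\|y-x\|$ for all $x,y$, and $\mu$-strongly convex if $\langle\nabla f(y)-\nabla f(x),y-x\rangle\ge\mu\|y-x\|^2$ for all $x,y$. For $\mathbf{x}=(x_1^T,\dots,x_n^T)^T\in\mathbb{R}^{nd}$ with $x_i\in\mathbb{R}^d$, put $f(\mathbf{x})=\sum_{i}f_i(x_i)$, $h(\mathbf{x})=\sum_i h_i(x_i)$. $W=(w_{ij})\in\mathbb{R}^{n\times n}$ is an averaging matrix associated with $\mathcal G$: it is symmetric and doubly stochastic (non-negative, rows and columns sum to 1), and $w_{ij}>0$ if $\{i,j\}\in\mathcal E$ or $i=j$, $w_{ij}=0$ otherwise. $\mathbf{W}=W\otimes I_d$. $\operatorname{prox}_{g}(x)=\arg\min_y\, g(y)+\frac12\|y-x\|^2$. Synchronous Prox-DGD with step-size $\alpha>0$: $\mathbf{x}^{k+1}=\operatorname{prox}_{\alpha h}(\mathbf{W}\mathbf{x}^k-\alpha\nabla f(\mathbf{x}^k))$; a fixed point is $\mathbf{x}^\star$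 with $\mathbf{x}^\star=\operatorname{prox}_{\alpha h}(\mathbf{W}\mathbf{x}^\star-\alpha\nabla f(\mathbf{x}^\star))$. Asynchronous Prox-DGD with step-size $\alpha$: for each $i\in\mathcal V$ and $k\in\mathbb{N}_0=\{0,1,2,\dots\}$, $$x_i^{k+1}=\begin{cases}\operatorname{prox}_{\alpha h_i}\bigl(\sum_{j\in\bar{\mathcal N}_i}w_{ij}x_j^{s_{ij}^k}-\alpha\nabla f_i(x_i^k)\bigr),&k\in\mathcal K_i,\\ x_i^k,&\text{otherwise},\end{cases}$$ where $\mathcal K_i\subseteq\mathbb{N}_0$ is the set of iterations at which node $i$ is active (the sets $\mathcal K_i$ need not be disjoint), the integer $s_{ij}^k\in[0,k]$ is the iteration index of the most recent version of $x_j$ available to node $i$ at iteration $k$, and $s_{ii}^k=k$. *)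

(* Defs.v *)
From mathcomp Require Export all_boot all_order all_algebra.
From mathcomp Require Export all_classical all_reals all_analysis.

Set Implicit Arguments.
Unset Strict Implicit.
Unset Printing Implicit Defensive.

Import Order.TTheory GRing.Theory Num.Theory.
Export numFieldNormedType.Exports.

Local Open Scope classical_set_scope.
Local Open Scope ring_scope.

(* A stacked vector (x_1^T, ..., x_n^T)^T of R^(nd), with blocks x_i in R^d, is
   represented by the n x d matrix whose i-th row is x_i.  The notions below are
   stated on 'M[R]_(m, p), and so apply both to R^d = 'M[R]_(1, d) and to the
   stacked space. *)

Section Euclidean.
Context {R : realType} {m p : nat}.
Implicit Types u v : 'M[R]_(m, p).

Definition dotp u v : R := \sum_i \sum_j u i j * v i j.

(* The library norm `|u| is the sup norm; it induces the same topology. *)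
Definition enorm u : R := Num.sqrt (dotp u u).

Definition grad (f : 'M[R]_(m, p) -> R) (x : 'M[R]_(m, p)) : 'M[R]_(m, p) :=
  \matrix_(i, j) 'D_(delta_mx i j) f x.

Definition smooth (L : R) (f : 'M[R]_(m, p) -> R) : Prop :=
  (forall x, differentiable f x) /\
  forall x y, enorm (grad f y - grad f x) <= L * enorm (y - x).

Definition strongly_convex (mu : R) (f : 'M[R]_(m, p) -> R) : Prop :=
  (forall x, differentiable f x) /\
  forall x y, mu * enorm (y - x) ^+ 2 <= dotp (grad f y - grad f x) (y - x).

End Euclidean.

Section ExtendedValued.
Context {R : realType} {V : normedModType R}.
Implicit Types g : V -> \bar R.

Definition proper_fun g : Prop :=
  (forall x, g x != -oo%E) /\ exists x, (g x < +oo)%E.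

Definition epigraph g : set (V * R) := [set q | (g q.1 <= q.2%:E)%E].

Definition closed_fun g : Prop := closed (epigraph g).

(* Intended for functions that never take the value -oo; note 0 * +oo = 0. *)
Definition convex_fun g : Prop :=
  forall (x y : V) (t : R), 0 <= t <= 1 ->
    (g (t *: x + (1 - t) *: y)%R <= t%:E * g x + (1 - t)%:E * g y)%E.

Definition proper_closed_convex g : Prop :=
  [/\ proper_fun g, closed_fun g & convex_fun g].

Definition bounded_below g : Prop := exists m : R, forall x, (m%:E <= g x)%E.

(* Minimizers are required to be feasible: argmin of the constant +oo is empty. *)
Definition argmin g : set V :=
  [set z | (g z < +oo)%E /\ forall y, (g z <= g y)%E].

End ExtendedValued.

(* [get] picks an element of the argmin, which is a singleton when g is proper,
   closed and convex (and returns a default value if the argmin is empty). *)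
Definition prox {R : realType} {m p : nat} (g : 'M[R]_(m, p) -> \bar R)
    (x : 'M[R]_(m, p)) : 'M[R]_(m, p) :=
  get (argmin (fun y => (g y + (2^-1 * enorm (y - x) ^+ 2)%:E)%E)).

Definition connected_graph {T : finType} (E : rel T) : Prop :=
  [/\ symmetric E, irreflexive E & forall i j, connect E i j].

Definition neighbor {T : finType} (E : rel T) (i : T) : {set T} :=
  [set j | E i j]%SET.

Definition closed_neighbor {T : finType} (E : rel T) (i : T) : {set T} :=
  (i |: neighbor E i)%SET.

Definition averaging_matrix {R : realType} {n : nat} (E : rel 'I_n)
    (W : 'M[R]_n) : Prop :=
  [/\ W^T = W,
      (forall i j, 0 <= W i j),
      (forall i, \sum_j W i j = 1),
      (forall j, \sum_i W i j = 1) &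
      (forall i j, E i j || (i == j) -> 0 < W i j) /\
      (forall i j, ~~ (E i j || (i == j)) -> W i j = 0)].

Section ProxDGD.
Context {R : realType} {n d : nat}.
Variables (E : rel 'I_n) (W : 'M[R]_n).
Variables (f : 'I_n -> 'rV[R]_d -> R) (h : 'I_n -> 'rV[R]_d -> \bar R).

Definition stacked_f (X : 'M[R]_(n, d)) : R := \sum_i f i (row i X).

Definition stacked_h (X : 'M[R]_(n, d)) : \bar R := (\sum_i h i (row i X))%E.

Definition objective (x : 'rV[R]_d) : \bar R :=
  (\sum_i ((f i x)%:E + h i x))%E.

(* W *m X is the action of the Kronecker product of W and I_d on X: its i-th
   block is \sum_j W i j *: row j X. *)
Definition sync_fixed_point (alpha : R) (X : 'M[R]_(n, d)) : Prop :=
  X = prox (fun Y => alpha%:E * stacked_h Y)%E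
           (W *m X - alpha *: grad stacked_f X).

(* K i is the set of iterations at which node i is active; s i j k is the
   iteration index of the version of x_j available to node i at iteration k,
   meaningful only for j in the closed neighborhood of i. *)
Variables (K : 'I_n -> set nat) (s : 'I_n -> 'I_n -> nat -> nat).

Definition admissible_delays : Prop :=
  (forall i j k, j \in closed_neighbor E i -> (s i j k <= k)%N) /\
  (forall i k, s i i k = k).

Definition total_asynchrony : Prop :=
  (forall i, infinite_set (K i)) /\
  (forall i j, j \in neighbor E i -> s i j @ \oo --> \oo).

Definition async_prox_dgd (alpha : R) (X0 : 'M[R]_(n, d))
    (X : nat -> 'M[R]_(n, d)) : Prop :=
  X 0%N = X0 /\
  forall i k,
    (K i k ->
       row i (X k.+1) =
       prox (fun y => alpha%:E * h i y)%E
            (\sum_(j in closed_neighbor E i) W i j *: row j (X (s i j k))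
             - alpha *: grad (f i) (row i (X k)))) /\
    (~ K i k -> row i (X k.+1) = row i (X k)).

End ProxDGD.

(* Main.v *)
(* The update of node i is nonexpansive in the received x_j, with weights w_ij,
   followed by the nonexpansive prox.  In its own variable the map
   x |-> w_ii x - alpha grad f_i x has a Lipschitz constant < w_ii: by
   cocoercivity of grad f_i and strong convexity,
     |w v - alpha g|^2 <= (w^2 - alpha (2 w - alpha L) mu) |v|^2
   for v = y - x and g = grad f_i y - grad f_i x.  Since sum_j w_ij = 1, the
   synchronous map is a contraction in the block norm max_i |x_i|, and such
   contractions tolerate total asynchrony. *)

Require Import Defs.
From HB Require Import structures.
From mathcomp Require Import all_boot all_order all_algebra.
From mathcomp Require Import all_classical all_reals all_analysis.
From mathcomp Require Import ring lra.

Set Implicit Arguments.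
Unset Strict Implicit.
Unset Printing Implicit Defensive.

Import Order.TTheory GRing.Theory Num.Theory.
Import numFieldNormedType.Exports.

Local Open Scope classical_set_scope.
Local Open Scope ring_scope.

(** * Euclidean inner product and norm, compared with the sup norm *)

Section EuclideanTheory.
Context {R : realType} {m p : nat}.
Implicit Types (u v w : 'M[R]_(m, p)) (a : R).

Lemma dotpC u v : dotp u v = dotp v u.
Proof. by apply: eq_bigr => i _; apply: eq_bigr => j _; rewrite mulrC. Qed.

Lemma dotpDl u v w : dotp (u + v) w = dotp u w + dotp v w.
Proof.
rewrite /dotp -big_split; apply: eq_bigr => i _ /=.
by rewrite -big_split; apply: eq_bigr => j _ /=; rewrite mxE mulrDl.
Qed.

Lemma dotpZl a u v : dotp (a *: u) v = a * dotp u v.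
Proof.
rewrite /dotp mulr_sumr; apply: eq_bigr => i _.
by rewrite mulr_sumr; apply: eq_bigr => j _; rewrite mxE mulrA.
Qed.

Lemma dotpDr u v w : dotp w (u + v) = dotp w u + dotp w v.
Proof. by rewrite dotpC dotpDl !(dotpC _ w). Qed.

Lemma dotpZr a u v : dotp v (a *: u) = a * dotp v u.
Proof. by rewrite dotpC dotpZl dotpC. Qed.

Lemma dotpNl u v : dotp (- u) v = - dotp u v.
Proof. by rewrite -scaleN1r dotpZl mulN1r. Qed.

Lemma dotpNr u v : dotp v (- u) = - dotp v u.
Proof. by rewrite dotpC dotpNl dotpC. Qed.

Definition dotpE := (dotpDl, dotpDr, dotpZl, dotpZr, dotpNl, dotpNr).

Lemma dotp_ge0 u : 0 <= dotp u u.
Proof. by apply: sumr_ge0 => i _; apply: sumr_ge0 => j _; rewrite -expr2 sqr_ge0. Qed.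

Lemma entry_sqr_le_dotp u i j : u i j ^+ 2 <= dotp u u.
Proof.
rewrite /dotp (bigD1 i)//= (bigD1 j)//= -expr2 -addrA lerDl addr_ge0//.
  by apply: sumr_ge0 => k _; rewrite -expr2 sqr_ge0.
by apply: sumr_ge0 => k _; apply: sumr_ge0 => l _; rewrite -expr2 sqr_ge0.
Qed.

Lemma dotp_eq0 u : dotp u u = 0 -> u = 0.
Proof.
move=> u0; apply/matrixP => i j; rewrite mxE.
have := entry_sqr_le_dotp u i j.
by rewrite u0 real_exprn_even_le0 ?num_real//= => /eqP.
Qed.

Lemma enorm_ge0 u : 0 <= enorm u.
Proof. exact: sqrtr_ge0. Qed.

Lemma sqr_enorm u : enorm u ^+ 2 = dotp u u.
Proof. by rewrite /enorm sqr_sqrtr ?dotp_ge0. Qed.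

Lemma enorm0 : enorm (0 : 'M[R]_(m, p)) = 0.
Proof. by rewrite /enorm -(scale0r 0) dotpZl mul0r sqrtr0. Qed.

Lemma enorm_eq0 u : enorm u = 0 -> u = 0.
Proof. by move=> u0; apply: dotp_eq0; rewrite -sqr_enorm u0 expr0n. Qed.

Lemma enormN u : enorm (- u) = enorm u.
Proof. by rewrite /enorm !dotpE opprK. Qed.

Lemma enormZ a u : enorm (a *: u) = `|a| * enorm u.
Proof. by rewrite /enorm !dotpE mulrA -expr2 sqrtrM ?sqr_ge0// sqrtr_sqr. Qed.

(** Cauchy-Schwarz, by expanding the squared norm of [enorm v *: u - enorm u *: v]. Zero norms are
    treated apart because the expansion is divided by [enorm u * enorm v]. *)
Lemma dotp_le_enorm u v : dotp u v <= enorm u * enorm v.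
Proof.
have h := dotp_ge0 (enorm v *: u - enorm u *: v).
have [u0|u0] := eqVneq (enorm u) 0.
  by rewrite (enorm_eq0 u0) -(scale0r 0) dotpZl mul0r enormZ normr0 !mul0r.
have [v0|v0] := eqVneq (enorm v) 0.
  by rewrite (enorm_eq0 v0) -(scale0r 0) dotpZr mul0r enormZ normr0 mul0r mulr0.
have uv0 : 0 < enorm u * enorm v.
  by rewrite mulr_gt0// lt_neqAle eq_sym ?u0 ?v0 enorm_ge0.
rewrite -(ler_pM2l uv0) -subr_ge0.
move: h; rewrite !dotpE (dotpC v u) -!sqr_enorm => h.
by nra.
Qed.

Lemma ler_enormD u v : enorm (u + v) <= enorm u + enorm v.
Proof.
rewrite -(@ler_pXn2r _ 2) ?nnegrE ?addr_ge0 ?enorm_ge0//.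
rewrite sqrrD !sqr_enorm !dotpE (dotpC v u) mulr2n.
have := dotp_le_enorm u v; lra.
Qed.

Lemma ler_enorm_sum (I : Type) (r : seq I) (P : pred I) (F : I -> 'M[R]_(m, p)) :
  enorm (\sum_(i <- r | P i) F i) <= \sum_(i <- r | P i) enorm (F i).
Proof.
elim/big_rec2: _ => [|i y z _ h]; first by rewrite enorm0.
by apply: le_trans (ler_enormD _ _) _; rewrite lerD2l.
Qed.

Lemma normr_entry_le_enorm u i j : `|u i j| <= enorm u.
Proof.
rewrite -(@ler_pXn2r _ 2) ?nnegrE ?enorm_ge0//.
by rewrite real_normK ?num_real// sqr_enorm entry_sqr_le_dotp.
Qed.

Lemma mx_norm_le_enorm u : `|u| <= enorm u.
Proof.
rewrite [leLHS]mx_normrE; apply/bigmax_leP; split; first exact: enorm_ge0.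
by move=> [i j] _; exact: normr_entry_le_enorm.
Qed.

Lemma normr_entry_le_mx_norm u i j : `|u i j| <= `|u|.
Proof.
by rewrite [leRHS]mx_normrE; apply: (le_bigmax _ (fun ij => `|u ij.1 ij.2|) (i, j)).
Qed.

Lemma continuous_dotp_subr w : continuous (fun u => dotp (u - w) (u - w)).
Proof.
apply: continuous_big => [|i _]; first exact: add_continuous.
apply: continuous_big => [|j _ u]; first exact: add_continuous.
have h : {for u, continuous (fun u : 'M[R]_(m, p) => (u - w) i j)}.
  rewrite (_ : (fun u : 'M[R]_(m, p) => _) = fun u => u i j - w i j); last first.
    by apply/funext => v; rewrite !mxE.
  by apply: continuousB; [exact: coord_continuous | exact: cst_continuous].
exact: continuousM.
Qed.

End EuclideanTheory.

(** * Smoothness, strong convexity and cocoercivity of gradients *)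

Section GradientTheory.
Context {R : realType} {m p : nat}.
Implicit Types (f : 'M[R]_(m, p) -> R) (x y v : 'M[R]_(m, p)).

Lemma derive_grad f x v : differentiable f x -> 'D_v f x = dotp (grad f x) v.
Proof.
move=> df; rewrite deriveE// {1}[v]matrix_sum_delta linear_sum.
apply: eq_bigr => i _; rewrite linear_sum; apply: eq_bigr => j _.
by rewrite linearZ /= mxE deriveE// mulrC.
Qed.

Lemma is_derive_line f x v (t : R) : differentiable f (x + t *: v) ->
  is_derive t 1 (fun s : R => f (x + s *: v)) (dotp (grad f (x + t *: v)) v).
Proof.
move=> df; have quotE : (fun h : R => h^-1 *:
      (((fun s : R => f (x + s *: v)) \o shift t) (h *: 1) - f (x + t *: v))) =
    (fun h : R => h^-1 *: ((f \o shift (x + t *: v)) (h *: v) - f (x + t *: v))).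
  by apply/funext => h; rewrite /= [h *: 1]mulr1 scalerDl addrCA.
have dfv : derivable f (x + t *: v) v by exact: diff_derivable.
by split; [rewrite /derivable quotE | rewrite /derive quotE -derive_grad].
Qed.

(** Subtracting [t * g + c / 2 * t ^+ 2] from [f] along the segment leaves a function [phi] whose
    derivative is nonpositive for [t > 0]; the mean value theorem then gives [phi 1 <= phi 0], with
    no integral involved. *)
Lemma gradient_increment_le f x v (c : R) :
  (forall y, differentiable f y) ->
  (forall t : R, 0 < t -> dotp (grad f (x + t *: v) - grad f x) v <= c * t) ->
  f (x + v) <= f x + dotp (grad f x) v + c / 2.
Proof.
move=> df le_ct; set g := dotp (grad f x) v.
pose phi (t : R) := f (x + t *: v) - (t * g + c / 2 * t ^+ 2).
pose dphi (t : R) := dotp (grad f (x + t *: v)) v - (g + c * t).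
have dphiP (t : R) : is_derive t 1 phi (dphi t).
  apply: is_deriveB; first exact: is_derive_line.
  by apply: is_derive_eq; rewrite /GRing.scale /=; field.
have cont : {within `[0, 1], continuous phi}.
  apply: continuous_subspaceT => s; apply: differentiable_continuous.
  by apply/derivable1_diffP; case: (dphiP s).
have [t /[!in_itv]/= /andP[t0 _]] := MVT ltr01 (fun t _ => dphiP t) cont.
have := le_ct t t0; rewrite dotpDl dotpNl -/g /phi /dphi.
rewrite !scale1r !scale0r addr0 => le eq.
lra.
Qed.

(** The descent lemma: by Cauchy-Schwarz and the Lipschitz bound, the gradient increment along [v]
    grows at rate [c = L * enorm v ^+ 2]. *)
Lemma smooth_upper_bound (L : R) f x v : 0 < L -> smooth L f ->
  f (x + v) <= f x + dotp (grad f x) v + L / 2 * enorm v ^+ 2.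
Proof.
move=> L0 [df fL]; rewrite mulrAC; apply: gradient_increment_le => // t t0.
apply: (le_trans (dotp_le_enorm _ _)).
rewrite mulrAC expr2 mulrA.
rewrite ler_wpM2r ?enorm_ge0//; apply: (le_trans (fL _ _)).
by rewrite addrAC subrr add0r enormZ gtr0_norm// mulrA.
Qed.

(** The mean value theorem writes [f y - f x] as the slope at some [x + t *: v]; monotonicity of the
    gradient between [x] and that point, divided by [t], shows that this slope is at least the one
    at [x]. *)
Lemma strongly_convex_gradient_inequality (mu : R) f x y : 0 <= mu ->
  strongly_convex mu f -> f x + dotp (grad f x) (y - x) <= f y.
Proof.
move=> mu0 [df sc].
set v := y - x; pose phi (t : R) := f (x + t *: v).
have dphiP (t : R) : is_derive t 1 phi (dotp (grad f (x + t *: v)) v).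
  exact: is_derive_line.
have cont : {within `[0, 1], continuous phi}.
  apply: continuous_subspaceT => s; apply: differentiable_continuous.
  by apply/derivable1_diffP; case: (dphiP s).
have [t /[!in_itv]/= /andP[t0 _]] := MVT ltr01 (fun t _ => dphiP t) cont.
rewrite /phi scale1r scale0r addr0 subr0 mulr1 [x + v]addrC subrK => eq.
have := sc x (x + t *: v); rewrite addrAC subrr add0r dotpZr => le.
have : 0 <= t * dotp (grad f (x + t *: v) - grad f x) v.
  by apply: le_trans le; rewrite mulr_ge0// sqr_ge0.
rewrite pmulr_rge0// dotpDl dotpNl; lra.
Qed.

(* Baillon-Haddad: the Bregman distance of f to x is nonnegative at the gradient
   step y - (grad f y - grad f x) / L, and the descent lemma bounds it there. *)
Lemma bregman_lower_bound (L mu : R) f x y : 0 < L -> 0 <= mu ->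
  smooth L f -> strongly_convex mu f ->
  f x + dotp (grad f x) (y - x) + enorm (grad f y - grad f x) ^+ 2 / (2 * L)
    <= f y.
Proof.
move=> L0 mu0 fL fmu; set g := grad f y - grad f x.
have := strongly_convex_gradient_inequality x (y - L^-1 *: g) mu0 fmu.
have := smooth_upper_bound y (- (L^-1 *: g)) L0 fL.
rewrite -scalerN enormZ enormN exprMn real_normK ?num_real// sqr_enorm.
have gE : grad f y = g + grad f x by rewrite subrK.
move: gE; clearbody g => ->; rewrite addrAC !dotpE.
have -> : dotp g g / (2 * L) = L^-1 * dotp g g - L / 2 * (L^-1 ^+ 2 * dotp g g).
  by field; rewrite gt_eqF.
lra.
Qed.

(** Adding the Bregman bound to its copy with [x] and [y] exchanged cancels the function values. *)
Lemma gradient_cocoercive (L mu : R) f x y : 0 < L -> 0 <= mu ->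
  smooth L f -> strongly_convex mu f ->
  enorm (grad f y - grad f x) ^+ 2 <= L * dotp (grad f y - grad f x) (y - x).
Proof.
move=> L0 mu0 fL fmu.
have := bregman_lower_bound x y L0 mu0 fL fmu.
have := bregman_lower_bound y x L0 mu0 fL fmu.
rewrite -(opprB (grad f y)) enormN -(opprB y) dotpNr [dotp (_ - _) _]dotpDl dotpNl.
set N := enorm _ ^+ 2 => h1 h2.
have : N / (2 * L) <= (dotp (grad f y) (y - x) - dotp (grad f x) (y - x)) / 2.
  lra.
rewrite ler_pdivrMr ?mulr_gt0//; lra.
Qed.

(** In the expanded square, cocoercivity trades [alpha ^+ 2 * dotp g g] for a multiple of
    [dotp g v]. The total coefficient of [dotp g v] is then [- alpha * (2 * w - alpha * L)],
    nonpositive by the step-size bound, so strong convexity finishes. *)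
Lemma gradient_step_contraction (L mu alpha w : R) f x y :
  0 < L -> 0 < mu -> 0 <= alpha -> alpha * L <= 2 * w ->
  smooth L f -> strongly_convex mu f ->
  enorm ((w *: y - alpha *: grad f y) - (w *: x - alpha *: grad f x)) ^+ 2
    <= (w ^+ 2 - alpha * (2 * w - alpha * L) * mu) * enorm (y - x) ^+ 2.
Proof.
move=> L0 mu0 alpha0 alphaL fL fmu.
have coco := gradient_cocoercive x y L0 (ltW mu0) fL fmu.
have [_ /(_ x y) sc] := fmu.
rewrite (_ : _ - _ = w *: (y - x) - alpha *: (grad f y - grad f x)); last first.
  by rewrite !scalerBr !opprD !opprK addrACA.
move: coco sc; set g := _ - grad f x; set v := y - x.
clearbody g v; rewrite !sqr_enorm => coco sc; rewrite !dotpE (dotpC v g).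
have := ler_wpM2l (sqr_ge0 alpha) coco.
have : 0 <= alpha * (2 * w - alpha * L) by rewrite mulr_ge0// subr_ge0.
move=> /ler_wpM2l/(_ _ _ sc).
lra.
Qed.

End GradientTheory.

(** * Variational inequality, nonexpansiveness and uniqueness for proximal points *)

Section ProxTheory.
Context {R : realType} {m p : nat}.
Implicit Types (g : 'M[R]_(m, p) -> \bar R) (x y z : 'M[R]_(m, p)).

Definition prox_objective g x y : \bar R :=
  (g y + (2^-1 * enorm (y - x) ^+ 2)%:E)%E.

Lemma argmin_prox_objective_lty g x z :
  argmin (prox_objective g x) z -> (g z < +oo)%E.
Proof.
move=> [+ _]; rewrite /prox_objective.
by case: (g z) => [r _||//]; [rewrite ltry | rewrite addye].
Qed.

(** The optimality condition of the prox, without subgradients: if it failed by [delta > 0], a point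
    of the segment from [z] to [y] would have a smaller objective than [z]. *)
Lemma argmin_variational g x z y : (forall u, g u != -oo%E) -> convex_fun g ->
  argmin (prox_objective g x) z -> (g y < +oo)%E ->
  (g z + (dotp (x - z) (y - z))%:E <= g y)%E.
Proof.
move=> gNy cvxg /[dup] /argmin_prox_objective_lty gz_lty [_].
rewrite /prox_objective => zmin gy_lty.
have gyfin : g y \is a fin_num by rewrite fin_numE gNy -ltey.
have gzfin : g z \is a fin_num by rewrite fin_numE gNy -ltey.
move: gyfin gzfin (cvxg y z) zmin => /fineK <- /fineK <-.
set a := fine (g y); set b := fine (g z) => cvx zmin.
rewrite -EFinD lee_fin leNgt; apply/negP => lt_ab.
pose S := dotp (y - z) (y - z); have S0 : 0 <= S by exact: dotp_ge0.
set e := dotp (x - z) (y - z) in lt_ab *.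
pose delta := b + e - a; have delta0 : 0 < delta by rewrite subr_gt0.
(* Minimality of [z] and convexity give [t * delta <= t ^+ 2 * S / 2], so any [t] in (0, 1] with
   [t * S < 2 * delta] is contradictory. This one satisfies [t * S < delta], and makes sense when
   [S = 0] too. *)
pose t := delta / (delta + S).
have dS0 : 0 < delta + S by rewrite ltr_wpDr.
have t01 : 0 <= t <= 1.
  rewrite /t divr_ge0 ?(ltW delta0) ?(ltW dS0)//=.
  by rewrite (ler_pdivrMr _ _ dS0) mul1r lerDl.
have t0 : 0 < t by rewrite divr_gt0.
have tS : t * (delta + S) = delta by rewrite /t divfK// gt_eqF.
have := zmin (t *: y + (1 - t) *: z).
have /leeD/(_ (lexx (2^-1 * enorm (t *: y + (1 - t) *: z - x) ^+ 2)%:E)) := cvx t t01.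
move=> /[swap] /le_trans /[apply].
rewrite -!EFinM -!EFinD lee_fin.
have -> : t *: y + (1 - t) *: z - x = t *: (y - z) - (x - z).
  by rewrite scalerBl scale1r scalerBr opprB !addrA [_ - _ + z]addrAC.
rewrite -(opprB x z) enormN !sqr_enorm.
have -> : dotp (t *: (y - z) - (x - z)) (t *: (y - z) - (x - z)) =
    t ^+ 2 * S - 2 * t * e + dotp (x - z) (x - z).
  rewrite /S /e; move: (y - z) (x - z) => v w.
  by rewrite !dotpE (dotpC v w); ring.
have P := mulr_gt0 t0 delta0; have tP := mulr_gt0 t0 P.
have := congr1 ( *%R t) tS.
rewrite /delta in P tP *; lra.
Qed.

(** Testing each variational inequality at the other minimizer and adding, the values of [g] cancel
    and leave [enorm (z' - z) ^+ 2 <= dotp (x' - x) (z' - z)]. Taking [x' = x] yields uniqueness. *)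
Lemma argmin_prox_nonexpansive g x x' z z' :
  (forall u, g u != -oo%E) -> convex_fun g ->
  argmin (prox_objective g x) z -> argmin (prox_objective g x') z' ->
  enorm (z' - z) <= enorm (x' - x).
Proof.
move=> gNy cvxg zmin z'min.
have gzfin : g z \is a fin_num.
  by rewrite fin_numE gNy -ltey (argmin_prox_objective_lty zmin).
have gz'fin : g z' \is a fin_num.
  by rewrite fin_numE gNy -ltey (argmin_prox_objective_lty z'min).
have := argmin_variational gNy cvxg zmin (argmin_prox_objective_lty z'min).
have := argmin_variational gNy cvxg z'min (argmin_prox_objective_lty zmin).
move: gzfin gz'fin => /fineK <- /fineK <-; rewrite -!EFinD !lee_fin => h1 h2.
have {h1 h2} : enorm (z' - z) ^+ 2 <= enorm (x' - x) * enorm (z' - z).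
  apply: (le_trans _ (dotp_le_enorm _ _)); rewrite sqr_enorm.
  move: h1 h2; rewrite !dotpE (dotpC z z'); lra.
have [->|] := eqVneq (enorm (z' - z)) 0; first by rewrite enorm_ge0.
by move=> z0; rewrite expr2 ler_pM2r// lt_neqAle eq_sym z0 enorm_ge0.
Qed.

Lemma argmin_prox_unique g x z z' :
  (forall u, g u != -oo%E) -> convex_fun g ->
  argmin (prox_objective g x) z -> argmin (prox_objective g x) z' -> z' = z.
Proof.
move=> gNy cvxg zmin z'min; apply/subr0_eq/enorm_eq0/le_anti.
rewrite enorm_ge0 andbT -(enorm0 (m := m) (p := p)) -(subrr x).
exact: argmin_prox_nonexpansive zmin z'min.
Qed.

End ProxTheory.

(** * Existence of proximal points by the direct method *)

Section ProxExistence.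
Context {R : realType} {d : nat}.
Implicit Types (g : 'rV[R]_d -> \bar R) (x y z : 'rV[R]_d).

Lemma enorm_ball_compact x (rho : R) : compact [set y | enorm (y - x) <= rho].
Proof.
have [rho0|rho0] := leP 0 rho; last first.
  rewrite (_ : [set y | _] = set0); first exact: compact0.
  rewrite -subset0 => y /= /le_lt_trans/(_ rho0).
  by rewrite ltNge enorm_ge0.
apply: bounded_closed_compact.
  exists (rho + `|x|); split; first exact: num_real.
  move=> M /ltW leM y /= le_rho; apply: (le_trans _ leM).
  rewrite -[y in leLHS](subrK x); apply: (le_trans (ler_normD _ _)).
  by rewrite lerD2r; apply: (le_trans (mx_norm_le_enorm _)).
have -> : [set y | enorm (y - x) <= rho] =
    (fun y => dotp (y - x) (y - x)) @^-1` [set r | r <= rho ^+ 2].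
  apply/seteqP; split => y /=; rewrite -sqr_enorm ler_pXn2r ?nnegrE ?enorm_ge0//.
apply: preimage_closed; last exact: closed_le.
by move=> y _; exact: continuous_dotp_subr.
Qed.

Lemma closed_fun_sublevel g (r : R) : closed_fun g ->
  closed [set y | (g y <= r%:E)%E].
Proof.
move=> clg; rewrite (_ : [set y | _] = (fun y => (y, r)) @^-1` epigraph g)//.
apply: preimage_closed => // y _.
by apply: (@cvg_pair _ _ _ (nbhs y) (nbhs y) (nbhs r));
  [exact: cvg_id | exact: cvg_cst].
Qed.

(** Sublevel sets are closed, so [g] is bounded below near each point; compactness makes the bound
    uniform. The bound is written [- M] with [M] tending to infinity to fit the near-covering form
    of compactness. *)
Lemma closed_fun_compact_lower_bound g (A : set 'rV[R]_d) :
  (forall x, g x != -oo%E) -> closed_fun g -> compact A ->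
  exists m : R, forall y, A y -> (m%:E <= g y)%E.
Proof.
move=> gNy clg /compact_near_coveringP cA.
have : \forall M \near +oo, A `<=` [set y | ((- M)%:E < g y)%E].
  apply: cA => x _.
  have [r rg] : exists r, (r%:E < g x)%E.
    case: (g x) (gNy x) => [r _||//].
      by exists (r - 1); rewrite lte_fin ltrBlDr ltrDl.
    by move=> _; exists 0; rewrite ltry.
  have : \forall y \near x, (r%:E < g y)%E.
    have /closed_openC := closed_fun_sublevel (r := r) clg.
    rewrite openE => /(_ x) /=.
    have nle : ~ (g x <= r%:E)%E by apply/negP; rewrite -ltNge.
    by move=> /(_ nle); apply: filterS => y /= /negP; rewrite -ltNge.
  move=> xr; exists ([set y | (r%:E < g y)%E], [set M | - r <= M]).
    by split=> //=; exact: nbhs_pinfty_ge (num_real _).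
  by move=> [y M] [/= ry rM]; apply: le_lt_trans ry; rewrite lee_fin lerNl.
move=> /filter_ex [M AM]; exists (- M) => y Ay; exact: ltW (AM y Ay).
Qed.

(** For [y] outside the unit ball, convexity is applied at the point of the segment from [x] to [y]
    at distance 1 from [x], where [g] is at least [m]. Hence [g] decreases at most linearly, which
    the quadratic term of the prox dominates. *)
Lemma convex_fun_affine_lower_bound g x (m : R) :
  (forall y, g y != -oo%E) -> convex_fun g -> (g x < +oo)%E ->
  (forall y, enorm (y - x) <= 1 -> (m%:E <= g y)%E) ->
  forall y, ((m - (fine (g x) - m) * enorm (y - x))%:E <= g y)%E.
Proof.
move=> gNy cvxg gx_lty le_m y.
have gxfin : g x \is a fin_num by rewrite fin_numE gNy -ltey.
set N := enorm (y - x); have N0 : 0 <= N by exact: enorm_ge0.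
have mgx : m <= fine (g x).
  by rewrite -lee_fin fineK// le_m// subrr enorm0.
have [N1|N1] := leP N 1.
  apply: le_trans (le_m _ N1); rewrite lee_fin lerBlDr lerDl mulr_ge0// subr_ge0//.
have [->|gy_nty] := eqVneq (g y) +oo%E; first by rewrite leey.
have gyfin : g y \is a fin_num by rewrite fin_numE gNy.
have N_gt0 : 0 < N by apply: lt_trans N1.
have t01 : 0 <= N^-1 <= 1 by rewrite invr_ge0 N0/= invf_le1// ltW.
have := cvxg y x _ t01.
have /le_m/le_trans/[apply] : enorm (N^-1 *: y + (1 - N^-1) *: x - x) <= 1.
  rewrite (_ : _ - x = N^-1 *: (y - x)).
    by rewrite enormZ ger0_norm ?invr_ge0// mulVf// gt_eqF.
  by rewrite scalerBl scale1r scalerBr [x - _]addrC addrA addrK.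
rewrite -(fineK gxfin) -(fineK gyfin) -!EFinM -EFinD !lee_fin.
move: (fine (g x)) (fine (g y)) mgx => b a mb le.
have : N * m <= N * (N^-1 * a + (1 - N^-1) * b) by rewrite ler_pM2l.
rewrite mulrDr !mulrA mulfV ?gt_eqF// mul1r mulrBr mulr1 mulfV ?gt_eqF//.
rewrite /=; lra.
Qed.

(** Minimizing over a compact piece of the epigraph replaces the extended-valued objective by the
    continuous function [psi], to which the extreme value theorem applies. *)
Lemma argmin_prox_exists g x :
  proper_closed_convex g -> argmin (prox_objective g x) !=set0.
Proof.
move=> [[gNy [x0 gx0_lty]] clg cvxg].
have gx0fin : g x0 \is a fin_num by rewrite fin_numE gNy -ltey.
have [m le_m] := closed_fun_compact_lower_bound gNy clg (@enorm_ball_compact x0 1).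
have affine := convex_fun_affine_lower_bound gNy cvxg gx0_lty le_m.
set b := fine (g x0) in affine.
have mb : m <= b by rewrite -lee_fin fineK// le_m//= subrr enorm0.
pose D := enorm (x0 - x); have D0 : 0 <= D by exact: enorm_ge0.
(* [c] is the value of the objective at [x0]. *)
pose c := b + 2^-1 * D ^+ 2.
have mc : m <= c by rewrite /c; have := sqr_ge0 D; lra.
(* At distance [N >= D] from [x0] the objective is at least [m + N * (N / 2 - D - (b - m))]. For
   [N > rho] the bracket exceeds [1 / 2 + (c - m)] and [N > 1], so the objective exceeds [c]. *)
pose rho := 2 * (D + (b - m)) + 1 + 2 * (c - m).
have far y : rho < enorm (y - x0) -> (c%:E < prox_objective g x y)%E.
  move=> rhoN; apply: lt_le_trans (leeD2r _ (affine y)).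
  rewrite -EFinD lte_fin.
  have : enorm (y - x0) - D <= enorm (y - x).
    rewrite lerBlDr -[X in X <= _]enormN opprB -[x0 - y](subrKA x) addrC.
    by rewrite -(opprB y x) -[enorm (y - x)]enormN opprB ler_enormD.
  move: (enorm (y - x0)) rhoN => N rhoN NM.
  have : (N - D) ^+ 2 <= enorm (y - x) ^+ 2.
    by rewrite ler_pXn2r ?nnegrE ?enorm_ge0//; rewrite /rho in rhoN; lra.
  move: (enorm (y - x)) => M NM2; rewrite /rho in rhoN.
  have N0 : 0 <= N * (N - rho) by apply: mulr_ge0; rewrite /rho; lra.
  have N1 : 0 <= (c - m) * (N - 1) by apply: mulr_ge0; lra.
  move: NM2 N0 N1; have := sqr_ge0 D; rewrite /rho /c; lra.
have [mr le_mr] := closed_fun_compact_lower_bound gNy clg (@enorm_ball_compact x0 rho).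
pose A := epigraph g `&` ([set y | enorm (y - x0) <= rho] `*` `[mr, c]).
have Ax0 : A (x0, b).
  split; first by rewrite /epigraph/= fineK.
  split; first by rewrite /= subrr enorm0 /rho; lra.
  rewrite /= in_itv/= lerDl mulr_ge0 ?sqr_ge0 ?invr_ge0// andbT.
  by rewrite -lee_fin fineK// le_mr//= subrr enorm0 /rho; lra.
have cA : compact A.
  rewrite /A setIC; apply: compact_closedI => //.
  by apply: compact_setX; [exact: enorm_ball_compact | exact: segment_compact].
pose psi (q : 'rV[R]_d * R) := q.2 + 2^-1 * dotp (q.1 - x) (q.1 - x).
have cpsi : continuous psi.
  move=> q; apply: continuousD; first exact: cvg_snd.
  apply: continuousM; first exact: cst_continuous.
  apply: (@continuous_comp _ _ _ fst (fun y => dotp (y - x) (y - x))).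
    exact: cvg_fst.
  exact: continuous_dotp_subr.
have [] := compact_EVT_min _ cA (continuous_subspaceT cpsi); first by exists (x0, b).
move=> [z r]; rewrite inE => -[/= zr _] psimin.
have zx0 : (prox_objective g x z <= (psi (z, r))%:E)%E.
  by rewrite /prox_objective /psi/= -sqr_enorm EFinD leeD2r.
have zc : (prox_objective g x z <= c%:E)%E.
  apply: (le_trans zx0); rewrite lee_fin; apply: (le_trans (psimin _ (mem_set Ax0))).
  by rewrite /psi /= -sqr_enorm.
exists z; split=> [|y]; first by rewrite (le_lt_trans zc)// ltry.
(* Points with objective above [c] cannot beat [z]; any other [y] lies in the ball with [g y <= c],
   so the truncated epigraph [A] contains its graph point. *)
have [yc|] := leP (prox_objective g x y) c%:E; last by move=> /ltW; exact: le_trans.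
have yrho : enorm (y - x0) <= rho.
  by rewrite leNgt; apply/negP => /far; rewrite ltNge yc.
have gyc : (g y <= c%:E)%E.
  apply: le_trans yc; rewrite /prox_objective leeDl// lee_fin.
  by rewrite mulr_ge0// sqr_ge0.
have gyfin : g y \is a fin_num.
  by rewrite fin_numE gNy/= -ltey (le_lt_trans gyc)// ltry.
apply: (le_trans zx0); rewrite /prox_objective -(fineK gyfin) -EFinD lee_fin.
rewrite sqr_enorm; apply: (psimin (y, fine (g y))); rewrite inE; split.
  by rewrite /epigraph/= fineK.
split=> //=; rewrite in_itv/= -!lee_fin fineK// gyc andbT.
exact: le_mr.
Qed.

End ProxExistence.

(** * The prox operator of a proper closed convex function *)

Section ProxOperator.
Context {R : realType} {d : nat}.
Implicit Types (g : 'rV[R]_d -> \bar R) (x y : 'rV[R]_d).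

Lemma scale_neqNy (t : R) (a : \bar R) : 0 <= t -> a != -oo%E -> (t%:E * a)%E != -oo%E.
Proof.
case: a => // t0 _; have [->|tn0] := eqVneq t 0; first by rewrite mul0e.
by rewrite gt0_muley// lte_fin lt_neqAle eq_sym tn0.
Qed.

Lemma scale_proper_closed_convex (alpha : R) g : 0 < alpha ->
  proper_closed_convex g -> proper_closed_convex (fun y => alpha%:E * g y)%E.
Proof.
move=> a0 [[gNy [x0 gx0]] clg cvxg]; split.
- split=> [x|]; first by rewrite scale_neqNy ?ltW.
  by exists x0; case: (g x0) gx0 (gNy x0) => // r _ _; rewrite -EFinM ltry.
- rewrite /closed_fun.
  have -> : epigraph (fun y => alpha%:E * g y)%E =
      (fun q : 'rV[R]_d * R => (q.1, alpha^-1 * q.2)) @^-1` epigraph g.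
    apply/seteqP; split=> -[y r]; rewrite /epigraph/= EFinM;
      by rewrite -lee_pdivlMl.
  apply: preimage_closed => // q _.
  apply: (@cvg_pair _ _ _ (nbhs q) (nbhs q.1) (nbhs (alpha^-1 * q.2))).
    exact: cvg_fst.
  apply: (@continuousM _ _ (cst alpha^-1) snd q); first exact: cst_continuous.
  exact: cvg_snd.
- move=> x y t t01; have := @lee_wpmul2l _ alpha%:E _ _ _ (cvxg x y t t01).
  rewrite lee_fin => /(_ (ltW a0))/le_trans; apply.
  rewrite muleDr//; first by rewrite !muleA -!EFinM (mulrC alpha) (mulrC alpha).
  have [t0 t1] : 0 <= t /\ 0 <= 1 - t by move: t01 => /andP[]; rewrite subr_ge0.
  by apply: ltninfty_adde_def; rewrite inE ltNye scale_neqNy.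
Qed.

(** Existence excludes the default value of [get] in [prox]. *)
Lemma prox_argmin g x : proper_closed_convex g ->
  argmin (prox_objective g x) (prox g x).
Proof. by move=> pccg; exact: getPex (argmin_prox_exists x pccg). Qed.

Lemma prox_nonexpansive g x y : proper_closed_convex g ->
  enorm (prox g y - prox g x) <= enorm (y - x).
Proof.
move=> pccg; have [[gNy _] _ cvxg] := pccg.
exact: argmin_prox_nonexpansive gNy cvxg (prox_argmin x pccg) (prox_argmin y pccg).
Qed.

End ProxOperator.

(** * Block decomposition of the stacked gradient and prox *)

Section Stacked.
Context {R : realType} {n d : nat}.
Implicit Types (f : 'I_n -> 'rV[R]_d -> R) (h : 'I_n -> 'rV[R]_d -> \bar R).
Implicit Types (X Y Z : 'M[R]_(n, d)).

(** Moving along [delta_mx i j] changes only block [i], so the difference quotients coincide as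
    functions before any limit is taken. *)
Lemma grad_stacked_f f X i : row i (grad (stacked_f f) X) = grad (f i) (row i X).
Proof.
apply/rowP => j; rewrite !mxE /derive; set q := (X in lim (X @ _)); set q' := (X in _ = lim (X @ _)).
suff -> : q = q' by [].
rewrite /q /q'; apply/funext => t /=; congr (_ *: _).
rewrite /stacked_f /= (bigD1 i)//= [X in _ - X](bigD1 i)//=.
rewrite [X in _ + X - _](eq_bigr (fun k => f k (row k X))) => [|k /negPf ki].
  rewrite opprD addrACA subrr addr0; congr (f i _ - _).
  by apply/rowP => k; rewrite !mxE !eqxx.
by congr (f k _); apply/rowP => l; rewrite !mxE ki /= mulr0 add0r.
Qed.

Lemma stacked_h_neqNy h Y : (forall i x, h i x != -oo%E) -> stacked_h h Y != -oo%E.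
Proof.
move=> hNy; apply/eqP => /esum_eqNyP[i [_ _ hi]].
by have := hNy i (row i Y); rewrite hi.
Qed.

Lemma scale_stacked_h h (alpha : R) Y : (forall i x, h i x != -oo%E) ->
  (alpha%:E * stacked_h h Y)%E = stacked_h (fun i y => alpha%:E * h i y)%E Y.
Proof.
move=> hNy; rewrite /stacked_h fin_num_sume_distrr// => i j _ _.
by apply: ltninfty_adde_def; rewrite inE ltNye hNy.
Qed.

Lemma convex_stacked_h h : (forall i x, h i x != -oo%E) ->
  (forall i, convex_fun (h i)) -> convex_fun (stacked_h h).
Proof.
move=> hNy cvxh X Y t t01; rewrite !scale_stacked_h// /stacked_h -big_split.
by apply: lee_sum => i _; rewrite !linearD !linearZ /=; exact: cvxh.
Qed.

Lemma prox_objective_stacked h Z Y :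
  prox_objective (stacked_h h) Z Y =
  (\sum_i prox_objective (h i) (row i Z) (row i Y))%E.
Proof.
rewrite /prox_objective big_split /= sumEFin; congr (_ + _%:E)%E.
rewrite sqr_enorm -mulr_sumr; congr (_ * _); apply: eq_bigr => i _.
by rewrite sqr_enorm /dotp big_ord1; apply: eq_bigr => j _; rewrite !mxE.
Qed.

(** The objective is separable, so the matrix [P] of blockwise proxes minimizes it term by term;
    uniqueness identifies [P] with the point chosen by [get]. *)
Lemma row_prox_stacked h Z i : (forall i, proper_closed_convex (h i)) ->
  row i (prox (stacked_h h) Z) = prox (h i) (row i Z).
Proof.
move=> pcch; pose P : 'M[R]_(n, d) := \matrix_j prox (h j) (row j Z).
have hNy j x : h j x != -oo%E by have [[]] := pcch j.
have Pmin : argmin (prox_objective (stacked_h h) Z) P.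
  split=> [|Y]; rewrite !prox_objective_stacked.
    by apply: lte_sum_pinfty => j _; rewrite rowK; case: (prox_argmin (row j Z) (pcch j)).
  by apply: lee_sum => j _; rewrite rowK; case: (prox_argmin (row j Z) (pcch j)) => _; apply.
rewrite -[RHS](rowK (fun j => prox (h j) (row j Z))) -/P; congr (row i _).
apply: get_unique => // Y; apply: argmin_prox_unique Pmin.
  by move=> Y'; exact: stacked_h_neqNy.
by apply: convex_stacked_h => // j; have [] := pcch j.
Qed.

End Stacked.

(** * Geometric decay of block errors under total asynchrony *)

Section AsynchronousContraction.
Context {R : realType}.

Lemma geometric_small (q C eps : R) : 0 <= q < 1 -> 0 < eps ->
  exists m, q ^+ m * C < eps.
Proof.
move=> /andP[q0 q1] eps0.
have qn1 : `|q| < 1 by rewrite ger0_norm.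
have /cvgr_lt/(_ _ eps0)/filter_ex[m] := @cvg_geometric R C q qn1.
by rewrite /geometric/= mulrC; exists m.
Qed.

Lemma infinite_set_nat_unbounded (A : set nat) N : infinite_set A ->
  exists2 k, A k & (N <= k)%N.
Proof.
move=> Ainf; apply: contrapT => noA; apply: Ainf.
apply: (sub_finite_set _ (finite_II N)) => k Ak /=.
by rewrite ltnNge; apply/negP => Nk; apply: noA; exists k.
Qed.

(* Once the delayed versions in use all postdate a stage, one update of each node
   starts the next. *)
Lemma async_contraction_stage (I : finType) (e : I -> nat -> R)
    (nb : I -> pred I) (K : I -> set nat) (s : I -> I -> nat -> nat) (q C : R) :
  0 <= q < 1 -> 0 <= C ->
  (forall i j k, nb i j -> (s i j k <= k)%N) ->
  (forall i, infinite_set (K i)) ->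
  (forall i j, nb i j -> s i j @ \oo --> \oo) ->
  (forall i k B, K i k -> (forall j, nb i j -> e j (s i j k) <= B) ->
     e i k.+1 <= q * B) ->
  (forall i k, ~ K i k -> e i k.+1 = e i k) ->
  (forall i, e i 0%N <= C) ->
  forall m, \forall k \near \oo, forall i, e i k <= q ^+ m * C.
Proof.
move=> /andP[q0 q1] C0 s_le Kinf s_cvg e_active e_idle e0.
elim=> [|m [N _ IH]].
  apply: nearW => k; rewrite expr0 mul1r; elim/ltn_ind: k => -[//|k] IH i.
  have [Kik|nKik] := pselect (K i k); last by rewrite e_idle//; exact: IH.
  apply: le_trans (e_active i k C Kik _) _ => [j nbij|].
    by apply: IH; rewrite ltnS s_le.
  by rewrite ler_piMl// ltW.
have [M _ s_geN] : \forall k \near \oo, forall i j, nb i j -> (N <= s i j k)%N.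
  apply: filter_forall => i; apply: filter_forall => j.
  have [nbij|nnbij] := boolP (nb i j); last by apply: nearW => k nbij; case/negP: nnbij.
  by have /cvgnyPge/(_ N) := s_cvg i j nbij; apply: filterS.
apply: filter_forall => i.
have [t Kit] := infinite_set_nat_unbounded (maxn M N) (Kinf i).
rewrite geq_max => /andP[Mt Nt].
have step k : (t <= k)%N -> K i k -> e i k.+1 <= q ^+ m.+1 * C.
  move=> tk Kik; rewrite exprS -mulrA; apply: e_active => // j nbij.
  by apply: IH; apply: s_geN nbij => /=; exact: leq_trans tk.
(* The update made at iteration [t] is visible from [t.+1] on; afterwards each iteration either
   updates within the new bound or keeps the value. *)
exists t.+1 => // k /= tk; elim: k tk => // k IHk; rewrite ltnS leq_eqVlt.
move=> /predU1P[<-|tk]; first exact: step.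
have [Kik|nKik] := pselect (K i k); first by apply: step => //; exact: ltnW.
by rewrite e_idle// IHk.
Qed.

End AsynchronousContraction.

(** Joins completeness with the normed structure of matrices, as the Banach fixed point theorem
    requires. *)
HB.instance Definition _ (R : realType) m n := Complete.on 'M[R]_(m, n).

(** * Fixed points of maps that contract the maximal block norm *)

Section BlockContraction.
Context {R : realType} {n d : nat}.
Implicit Types (X Y Z : 'M[R]_(n, d)).

Lemma mx_norm_le_row_enorm Z (b : R) : 0 <= b ->
  (forall i, enorm (row i Z) <= b) -> `|Z| <= b.
Proof.
move=> b0 leb; rewrite [leLHS]mx_normrE; apply/bigmax_leP; split=> // -[i j] _ /=.
have -> : Z i j = row i Z ord0 j by rewrite mxE.
exact: le_trans (normr_entry_le_enorm _ _ _) (leb i).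
Qed.

Lemma row_enorm_le_mx_norm Z i : enorm (row i Z) <= Num.sqrt d%:R * `|Z|.
Proof.
rewrite -[X in _ * X]ger0_norm// -sqrtr_sqr -sqrtrM// ler_wsqrtr//.
rewrite /dotp big_ord1 mulr_natl -[X in _ *+ X]card_ord -sumr_const.
apply: ler_sum => j _; rewrite !mxE -expr2 -(real_normK (num_real (Z i j))).
by rewrite ler_pXn2r ?nnegrE// normr_entry_le_mx_norm.
Qed.

(* In the sup norm only a high enough iterate of T is a contraction; its unique
   fixed point is then fixed by T. *)
Lemma block_contraction_fixed_point (T : 'M[R]_(n, d) -> 'M[R]_(n, d)) (q : R) :
  0 <= q < 1 ->
  (forall B X Y, (forall i, enorm (row i X - row i Y) <= B) ->
     forall i, enorm (row i (T X) - row i (T Y)) <= q * B) ->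
  exists X, T X = X.
Proof.
move=> q01 contrT; pose c : R := Num.sqrt d%:R.
have c0 : 0 <= c by exact: sqrtr_ge0.
have contr_iter k X Y i :
    enorm (row i (iter k T X) - row i (iter k T Y)) <= q ^+ k * (c * `|X - Y|).
  elim: k i => [|k IH] i /=; last by rewrite exprS -mulrA; exact: contrT.
  by rewrite expr0 mul1r -linearB row_enorm_le_mx_norm.
(* [k] is large enough for [q ^+ k] to absorb the constant [c] comparing block norms with the sup
   norm. *)
have [k qk] := geometric_small c q01 ltr01.
have q0 : 0 <= q ^+ k * c by rewrite mulr_ge0 ?exprn_ge0//; case/andP: q01.
have contr : is_contraction (totalfun (iter k T)).
  exists (NngNum q0); split=> //= -[X Y] _ /=.
  apply: mx_norm_le_row_enorm => [|i]; first by rewrite mulr_ge0.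
  by rewrite linearB -mulrA; exact: contr_iter.
have [||X _ XE] := banach_fixed_point contr; [exact: closedT | by exists 0 |].
exists X; apply: (contraction_fixpoint_unique contr) => //.
(* [T] commutes with its iterates, so [T X] is a fixed point of [iter k T] as well. *)
by rewrite {1}XE /totalfun_ -iterS iterSr.
Qed.

End BlockContraction.

(** * The synchronous Prox-DGD map, block by block *)

Section ProxDGDTheory.
Context {R : realType} {n d : nat}.
Variables (W : 'M[R]_n) (f : 'I_n -> 'rV[R]_d -> R).
Variables (h : 'I_n -> 'rV[R]_d -> \bar R) (alpha : R).
Implicit Types (Y Z : 'M[R]_(n, d)).

(** Block [i] of the synchronous map. The sum runs over all nodes, as in [W *m Z]; for an averaging
    matrix the weights outside the closed neighborhood vanish. *)
Definition dgd_block (i : 'I_n) Z : 'rV[R]_d :=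
  prox (fun y => alpha%:E * h i y)%E
    (\sum_j W i j *: row j Z - alpha *: grad (f i) (row i Z)).

Lemma sync_fixed_point_blocks Z : 0 < alpha ->
  (forall i, proper_closed_convex (h i)) ->
  (forall i, dgd_block i Z = row i Z) -> sync_fixed_point W f h alpha Z.
Proof.
move=> a0 pcch fixZ; apply/row_matrixP => i.
rewrite (_ : (fun Y => _) = stacked_h (fun i y => alpha%:E * h i y)%E); last first.
  by apply/funext => Y; apply: scale_stacked_h => j x; have [[]] := pcch j.
rewrite row_prox_stacked => [|j]; last exact: scale_proper_closed_convex.
have rowWZ : row i (W *m Z) = \sum_j W i j *: row j Z.
  by rewrite row_mul mulmx_sum_row; apply: eq_bigr => j _; rewrite mxE.
have rowE : row i (W *m Z - alpha *: grad (stacked_f f) Z) =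
    \sum_j W i j *: row j Z - alpha *: grad (f i) (row i Z).
  by rewrite linearB linearZ /= grad_stacked_f rowWZ.
rewrite rowE; exact: (esym (fixZ i)).
Qed.

(** The node's own block contributes a factor [rho < w] and the others [1 - w] in total, so the rate
    is [rho + (1 - w) < 1]. Only blocks of nonzero weight are constrained, because delayed data will
    be controlled only on the closed neighborhood. *)
Lemma dgd_block_contraction (L mu : R) (i : 'I_n) :
  0 < alpha -> 0 < L -> 0 < mu -> alpha * L < 2 * W i i ->
  (forall j, 0 <= W i j) -> \sum_j W i j = 1 ->
  proper_closed_convex (h i) -> smooth L (f i) -> strongly_convex mu (f i) ->
  exists2 q, 0 <= q < 1 &
    forall B Y Z, (forall j, W i j != 0 -> enorm (row j Y - row j Z) <= B) ->
      enorm (dgd_block i Y - dgd_block i Z) <= q * B.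
Proof.
move=> a0 L0 mu0 aL W0 W1 pcch fL fmu.
set w := W i i in aL; have w_gt0 : 0 < w.
  by rewrite -(pmulr_rgt0 _ (ltr0n R 2)); apply: lt_trans aL; rewrite mulr_gt0.
(* The Lipschitz constant given by [gradient_step_contraction]; the strict step-size bound puts it
   strictly below [w]. *)
pose rho := Num.sqrt (w ^+ 2 - alpha * (2 * w - alpha * L) * mu).
have rho0 : 0 <= rho by exact: sqrtr_ge0.
have rhow : rho < w.
  rewrite -(ger0_norm (ltW w_gt0)) -sqrtr_sqr ltr_sqrt ?exprn_gt0//.
  by rewrite ltrBlDr ltrDl !mulr_gt0// subr_gt0.
have sumW : \sum_(j | j != i) W i j = 1 - w.
  by rewrite -W1 [in RHS](bigD1 i)//= -/w addrAC subrr add0r.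
exists (rho + (1 - w)).
  rewrite addr_ge0//=; last by rewrite -sumW sumr_ge0.
  by rewrite addrCA gtrDl subr_lt0.
move=> B Y Z leB; rewrite /dgd_block.
apply: le_trans (prox_nonexpansive _ _ (scale_proper_closed_convex a0 pcch)) _.
rewrite (bigD1 i)//= [X in _ - (X - _)](bigD1 i)//= -/w.
set SY := \sum_(j | _) _; set SZ := \sum_(j | _) _.
rewrite (_ : _ - _ = (w *: row i Y - alpha *: grad (f i) (row i Y)
    - (w *: row i Z - alpha *: grad (f i) (row i Z))) + (SY - SZ)); last first.
  rewrite !opprD !opprK.
  by rewrite (addrAC _ SY) (addrAC _ (- SZ)) [LHS]addrACA.
apply: le_trans (ler_enormD _ _) _; rewrite mulrDl lerD//.
  have leBi : enorm (row i Y - row i Z) <= B by apply: leB; rewrite gt_eqF.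
  apply: (@le_trans _ _ (rho * enorm (row i Y - row i Z))); last exact: ler_wpM2l.
  rewrite -(ger0_norm (enorm_ge0 (row i Y - row i Z))) -sqrtr_sqr.
  rewrite mulrC -sqrtrM ?sqr_ge0// mulrC -[leLHS]ger0_norm ?enorm_ge0// -sqrtr_sqr.
  by apply: ler_wsqrtr; apply: gradient_step_contraction => //; exact: ltW.
rewrite -sumrB -sumW mulr_suml.
apply: le_trans (ler_enorm_sum _ _ _) _; apply: ler_sum => j _.
rewrite -scalerBr enormZ ger0_norm//.
have [->|Wij] := eqVneq (W i j) 0; first by rewrite !mul0r.
by rewrite ler_wpM2l// leB.
Qed.

End ProxDGDTheory.

(** * Convergence of asynchronous Prox-DGD *)

Theorem theorem1 (R : realType) (n d : nat) (E : rel 'I_n.+1)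
    (W : 'M[R]_n.+1) (f : 'I_n.+1 -> 'rV[R]_d -> R)
    (h : 'I_n.+1 -> 'rV[R]_d -> \bar R) (L mu : 'I_n.+1 -> R) (alpha : R)
    (K : 'I_n.+1 -> set nat) (s : 'I_n.+1 -> 'I_n.+1 -> nat -> nat)
    (graphE : connected_graph E)
    (avgW : averaging_matrix E W)
    (f_pcc : forall i, proper_closed_convex (fun x => (f i x)%:E))
    (h_pcc : forall i, proper_closed_convex (h i))
    (L_gt0 : forall i, 0 < L i)
    (f_smooth : forall i, smooth (L i) (f i))
    (fh_bounded : forall i, bounded_below (fun x => (f i x)%:E + h i x)%E)
    (opt_nonempty : argmin (objective f h) !=set0)
    (mu_gt0 : forall i, 0 < mu i)
    (f_strongly_convex : forall i, strongly_convex (mu i) (f i))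
    (delays : admissible_delays E s)
    (async : total_asynchrony E K s)
    (alpha_gt0 : 0 < alpha)
    (alpha_lt : alpha <
       2 * \big[Num.min/W ord0 ord0 / L ord0]_(i < n.+1) (W i i / L i))
    (X0 : 'M[R]_(n.+1, d)) (X : nat -> 'M[R]_(n.+1, d))
    (X_async : async_prox_dgd E W f h K s alpha X0 X) :
  exists Xstar : 'M[R]_(n.+1, d),
    sync_fixed_point W f h alpha Xstar /\ X @ \oo --> Xstar.
Proof.
have [_ W_ge0 W_row1 _ [_ W_off]] := avgW.
have W_nb i j : W i j != 0 -> j \in closed_neighbor E i.
  apply: contraR; rewrite !inE negb_or => /andP[ji Eij].
  by rewrite W_off// negb_or Eij eq_sym.
have alphaL i : alpha * L i < 2 * W i i.
  rewrite -ltr_pdivlMr// -mulrA; apply: lt_le_trans alpha_lt _.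
  by rewrite ler_pM2l// bigmin_le.
have qP i := dgd_block_contraction alpha_gt0 (L_gt0 i) (mu_gt0 i) (alphaL i)
  (W_ge0 i) (W_row1 i) (h_pcc i) (f_smooth i) (f_strongly_convex i).
pose q_ i := s2val (cid2 (qP i)).
have q_01 i : 0 <= q_ i < 1 := s2valP (cid2 (qP i)).
have q_contr i := s2valP' (cid2 (qP i)).
(* A common rate for all nodes; the default 0 is harmless since every [q_ i] is nonnegative. *)
pose q := \big[Num.max/0]_i q_ i.
have q_le i : q_ i <= q by exact: le_bigmax.
have q01 : 0 <= q < 1.
  rewrite bigmax_ge_id/=; apply/bigmax_ltP; split=> // i _.
  by have /andP[] := q_01 i.
have contr B (Y Z : 'M[R]_(n.+1, d)) i :
    (forall j, j \in closed_neighbor E i -> enorm (row j Y - row j Z) <= B) ->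
    enorm (dgd_block W f h alpha i Y - dgd_block W f h alpha i Z) <= q * B.
  move=> leB; have B0 : 0 <= B.
    by apply: le_trans (leB i _); [exact: enorm_ge0 | rewrite !inE eqxx].
  apply: (@le_trans _ _ (q_ i * B)); last exact: ler_wpM2r.
  by apply: q_contr => j /W_nb; exact: leB.
have [T rowT] : exists T : 'M[R]_(n.+1, d) -> 'M[R]_(n.+1, d),
    forall Z i, row i (T Z) = dgd_block W f h alpha i Z.
  by exists (fun Z => \matrix_i dgd_block W f h alpha i Z) => Z i; exact: rowK.
have [|Xs XsE] := @block_contraction_fixed_point R n.+1 d T q q01.
  move=> B Y Z leB i; rewrite (rowT Y i) (rowT Z i); apply: contr => j _; exact: leB.
have fixXs i : dgd_block W f h alpha i Xs = row i Xs by rewrite -rowT XsE.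
exists Xs; split; first exact: sync_fixed_point_blocks.
have [XE0 XE] := X_async; have [s_le s_ii] := delays; have [Kinf s_cvg] := async.
pose e i k := enorm (row i (X k) - row i Xs).
pose C := \big[Num.max/0]_i e i 0%N.
have stage := @async_contraction_stage R _ e (fun i => mem (closed_neighbor E i))
  K s q C q01 (bigmax_ge_id _ _ _ _).
have {}stage m : \forall k \near \oo, forall i, e i k <= q ^+ m * C.
  apply: stage => //; last by move=> i; exact: le_bigmax.
  (* Total asynchrony speaks of proper neighbors only; for the node itself [s i i] is the identity,
     which diverges. *)
  - move=> i j; rewrite !inE => /predU1P[->|]; last by move=> Eij; apply: s_cvg; rewrite inE.
    by rewrite (_ : s i i = id) ?cvg_id//; apply/funext => k; exact: s_ii.
  (* [Z] is the state as seen by node [i] at iteration [k]. Its row [i] is current since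
     [s i i k = k], and its rows outside the closed neighborhood have weight zero, so the
     asynchronous update is block [i] of the synchronous map at [Z]. *)
  - move=> i k B Kik leB; pose Z := \matrix_j row j (X (s i j k)).
    have rowZ j : row j Z = row j (X (s i j k)) by exact: rowK.
    have sumE : \sum_(j in closed_neighbor E i) W i j *: row j (X (s i j k)) =
        \sum_j W i j *: row j Z.
      rewrite [RHS](bigID (mem (closed_neighbor E i)))/= [X in _ + X]big1.
        by rewrite addr0; apply: eq_bigr => j _; rewrite rowZ.
      move=> j nnb; have [->|/W_nb] := eqVneq (W i j) 0; first by rewrite scale0r.
      by rewrite (negPf nnb).
    have rowX : row i (X k.+1) = dgd_block W f h alpha i Z.
      have [/(_ Kik) -> _] := XE i k.
      by rewrite sumE /dgd_block (rowZ i) s_ii.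
    rewrite /e rowX -fixXs; apply: contr => j nbij.
    by rewrite rowZ; exact: leB.
  - by move=> i k nKik; rewrite /e (XE i k).2.
apply/cvgrPdist_le => eps eps0.
have [m qm] := geometric_small C q01 eps0.
apply: filterS (stage m) => k le_e.
rewrite distrC; apply: mx_norm_le_row_enorm; first exact: ltW.
by move=> i; rewrite linearB; exact: le_trans (le_e i) (ltW qm).
Qed.
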